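(* Let $G=(V,E)$ be a connected graph on $n$ vertices with resistance Laplacian $\mathcal R$. The discrete optimization problem \[ \max_{(A,B)\text{ balanced partition of }V}\mathrm{RRC}(A,B) \] (where ''balanced'' means $n$ is even and $|A|=|B|=n/2$) has as its continuous relaxation the problem \[ \max_{x\in\mathbb R^n,\ \|x\|=1,\ x\perp\mathbf 1}x^\top\mathcal R\,x, \] whose maximizers are precisely the dominant eigenvectors of the resistance Laplacian.
   Context: $G$ is a finite, simple, connected, undirected, unweighted graph with vertex set $V=\{1,\dots,n\}$. $L$ is its combinatorial Laplacian (degree matrix minus adjacency matrix), $I$ is the identity matrix of order $n$, $\mathbf 1$ is the all-ones vector, and $L^\dagger$ is the Moore--Penrose inverse of $L$, i.e. the unique symmetric matrix with $LL^\dagger=L^\dagger L=I-\frac1n\mathbf 1\mathbf 1^\top$ and $L^\dagger\mathbf 1=\mathbf 0$. The effective resistance between $i$ and $j$ is $r_{ij}=(L^\dagger)_{ii}+(L^\dagger)_{jj}-2(L^\dagger)_{ij}$, the resistance matrix is $R=(r_{ij})$, and the resistance Laplacian is $\mathcal R=\operatorname{diag}(R\mathbf 1)-R$. For nonempty disjoint $A,B\subseteq V$ the resistance cut is $\mathrm{ResCut}(A,B)=\sum_{i\in A,\,j\in B}r_{ij}$, and the resistance ratio cut is $\mathrm{RRC}(A,B)=\mathrm{ResCut}(A,B)\left(\frac1{|A|}+\frac1{|B|}\right)$. Partitions are into two parts $A,B$. $\|\cdot\|$ is the Euclidean norm. ''Continuous relaxation'' is used in the usual sense of spectral clustering: the discrete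 indicator vectors of partitions are replaced by continuous (real-valued) variables. A dominant eigenvector of $\mathcal R$ is an eigenvector corresponding to its largest eigenvalue; here it is taken with unit norm, as the constraint $\|x\|=1$ requires. *)

(* Defs.v *)
From HB Require Import structures.
From mathcomp Require Import all_boot all_order all_algebra.
From mathcomp Require Import boolp classical_sets reals.

Set Implicit Arguments.
Unset Strict Implicit.
Unset Printing Implicit Defensive.

Import Order.TTheory GRing.Theory Num.Theory.
Local Open Scope classical_set_scope.
Local Open Scope ring_scope.

Definition ones (R : realType) (n : nat) : 'cV[R]_n := const_mx 1.

Definition dot (R : realType) (n : nat) (x y : 'cV[R]_n) : R :=
  (x^T *m y) ord0 ord0.

(* The norm MathComp-Analysis puts on matrices is the sup norm, so the Euclidean
   norm is defined by hand. *)
Definition enorm (R : realType) (n : nat) (x : 'cV[R]_n) : R :=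
  Num.sqrt (dot x x).

Definition qform (R : realType) (n : nat) (M : 'M[R]_n) (x : 'cV[R]_n) : R :=
  (x^T *m M *m x) ord0 ord0.

(* [eigenvalue] is defined through left (row) eigenvectors; a square matrix has
   the same eigenvalues on both sides. *)
Definition largest_eigenvalue (R : realType) (n : nat) (M : 'M[R]_n) (l : R) :
    Prop :=
  eigenvalue M l /\ forall m : R, eigenvalue M m -> m <= l.

Definition dominant_eigenvector (R : realType) (n : nat) (M : 'M[R]_n)
    (x : 'cV[R]_n) : Prop :=
  x != 0 /\ exists2 l : R, largest_eigenvalue M l & M *m x = l *: x.

(* A simple graph on 'I_n is given by a symmetric irreflexive adjacency relation
   [e]; these properties and connectedness are hypotheses of the theorem. *)

Definition adjacency (R : realType) (n : nat) (e : rel 'I_n) : 'M[R]_n :=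
  \matrix_(i, j) (e i j)%:R.

Definition degree (n : nat) (e : rel 'I_n) (i : 'I_n) : nat :=
  #|[set j | e i j]%SET|.

Definition laplacian (R : realType) (n : nat) (e : rel 'I_n) : 'M[R]_n :=
  diag_mx (\row_i (degree e i)%:R) - adjacency R e.

Definition is_laplacian_pinv (R : realType) (n : nat) (L P : 'M[R]_n) : Prop :=
  let C : 'M[R]_n := 1%:M - n%:R^-1 *: (ones R n *m (ones R n)^T) in
  [/\ P^T = P, L *m P = C, P *m L = C & P *m ones R n = 0].

(* [xget 0] selects the matrix with the stated properties; the value 0 is only
   used when there is none, which does not happen for a connected graph. *)
Definition laplacian_pinv (R : realType) (n : nat) (e : rel 'I_n) : 'M[R]_n :=
  xget 0 [set P : 'M[R]_n | is_laplacian_pinv (laplacian R e) P].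

Definition resistance (R : realType) (n : nat) (e : rel 'I_n) (i j : 'I_n) : R :=
  let P := laplacian_pinv R e in P i i + P j j - 2 * P i j.

Definition resistance_matrix (R : realType) (n : nat) (e : rel 'I_n) : 'M[R]_n :=
  \matrix_(i, j) resistance R e i j.

Definition resistance_laplacian (R : realType) (n : nat) (e : rel 'I_n) :
    'M[R]_n :=
  diag_mx (resistance_matrix R e *m ones R n)^T - resistance_matrix R e.

Definition ResCut (R : realType) (n : nat) (e : rel 'I_n) (A B : {set 'I_n}) : R :=
  \sum_(i in A) \sum_(j in B) resistance R e i j.

Definition RRC (R : realType) (n : nat) (e : rel 'I_n) (A B : {set 'I_n}) : R :=
  ResCut R e A B * (#|A|%:R^-1 + #|B|%:R^-1).

Definition bipartition (n : nat) (A B : {set 'I_n}) : Prop :=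
  [/\ A != finset.set0, B != finset.set0, (A :&: B)%SET = finset.set0
    & (A :|: B = [set: 'I_n])%SET].

Definition balanced (n : nat) (A B : {set 'I_n}) : Prop :=
  [/\ ~~ odd n, #|A| = n./2 & #|B| = n./2].

Record max_problem (R : realType) (T : Type) := MaxProblem {
  feasible : set T;
  objective : T -> R }.

Definition maximizer (R : realType) (T : Type) (p : max_problem R T) (x : T) :
    Prop :=
  feasible p x /\ forall y, feasible p y -> objective p y <= objective p x.

(* [q] is the continuous relaxation of the discrete problem [p] when [p], read
   through the indicator vectors [ind t], is exactly [q] with the additional
   restriction that all coordinates lie in the finite set [vals]; [q] is thus
   obtained by letting the coordinates be arbitrary real numbers. *)
Definition continuous_relaxation (R : realType) (T : Type) (n : nat)
    (ind : T -> 'cV[R]_n) (vals : seq R)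
    (p : max_problem R T) (q : max_problem R 'cV[R]_n) : Prop :=
  [/\ {in feasible p &, injective ind},
      ind @` feasible p
        = feasible q `&` [set x : 'cV[R]_n | forall i, x i ord0 \in vals]
    & forall t, feasible p t -> objective p t = objective q (ind t)].

Definition set_indicator (R : realType) (n : nat) (A : {set 'I_n}) : 'cV[R]_n :=
  \col_i (i \in A)%:R.

(* The normalized indicator vector: 1 / sqrt n on A and - 1 / sqrt n on B. *)
Definition partition_vector (R : realType) (n : nat)
    (AB : {set 'I_n} * {set 'I_n}) : 'cV[R]_n :=
  (Num.sqrt n%:R)^-1 *: (set_indicator R AB.1 - set_indicator R AB.2).

Definition balanced_RRC_problem (R : realType) (n : nat) (e : rel 'I_n) :
    max_problem R ({set 'I_n} * {set 'I_n}) :=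
  {| feasible := [set AB | bipartition AB.1 AB.2 /\ balanced AB.1 AB.2];
     objective := fun AB => RRC R e AB.1 AB.2 |}.

Definition relaxed_problem (R : realType) (n : nat) (e : rel 'I_n) :
    max_problem R 'cV[R]_n :=
  {| feasible := [set x : 'cV[R]_n | enorm x = 1 /\ dot x (ones R n) = 0];
     objective := qform (resistance_laplacian R e) |}.

(* Main.v *)
Require Import Defs.
From HB Require Import structures.
From mathcomp Require Import all_boot all_order all_algebra.
From mathcomp Require Import boolp classical_sets reals.
From mathcomp Require Import topology normedtype derive.
From mathcomp Require Import ring lra.

Set Implicit Arguments.
Unset Strict Implicit.
Unset Printing Implicit Defensive.

Import Order.TTheory GRing.Theory Num.Theory.
Import numFieldNormedType.Exports.
Local Open Scope ring_scope.

(** Resistances and graph Laplacians share one shape: for a symmetric matrix [W]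
    of weights, the matrix [diag (W 1) - W] has the quadratic form
    [1/2 sum_ij W_ij (x_i - x_j)^2] and kills the constants.

    Evaluated at [+- 1 / sqrt n] on the two sides of a partition, this form is
    [4 / n] times the weight of the cut, and for two sides of size [n / 2] the
    factor [1 / |A| + 1 / |B|] is also [4 / n].  Such a vector has unit norm,
    and it is orthogonal to the constants exactly when the sides are balanced;
    hence the discrete problem is the restriction of the continuous one to
    vectors with these two values ([partition_vector_relaxation]).

    A maximizer [x] of the continuous problem exists by compactness.  Let [l] be
    its value.  As the constants lie in the kernel and [l >= 0], the matrix
    [l I - M], with [M] the resistance Laplacian, is positive semidefinite on
    the whole space; its form vanishes at [x], hence so does [(l I - M) x]
    ([psd_qform_eq0]).  So [x] is an eigenvector, and [l] bounds every
    eigenvalue.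

    The converse needs a dominant eigenvector to be orthogonal to the constants,
    which holds as soon as the top eigenvalue is positive.  This is where the
    graph enters: connectedness makes the Laplacian invertible off the
    constants, so that its pseudoinverse exists, and the resistance between two
    distinct vertices is then the energy of a nonconstant potential
    ([resistance_gt0]).  With all resistances positive, the form of [M] is
    positive at every nonzero vector orthogonal to the constants. *)

(** * Dot products and quadratic forms *)

Section QuadraticForms.
Variables (R : realType) (n : nat).
Implicit Types (M : 'M[R]_n) (x y z : 'cV[R]_n).

Lemma dotE x y : dot x y = \sum_i x i ord0 * y i ord0.
Proof. by rewrite /dot mxE; apply: eq_bigr => i _; rewrite mxE. Qed.

Lemma dotC x y : dot x y = dot y x.
Proof. by rewrite !dotE; apply: eq_bigr => i _; rewrite mulrC. Qed.

Lemma dotDl x y z : dot (x + y) z = dot x z + dot y z.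
Proof. by rewrite /dot linearD mulmxDl mxE. Qed.

Lemma dotDr x y z : dot x (y + z) = dot x y + dot x z.
Proof. by rewrite /dot mulmxDr mxE. Qed.

Lemma dotZl a x y : dot (a *: x) y = a * dot x y.
Proof. by rewrite /dot linearZ -scalemxAl mxE. Qed.

Lemma dotZr a x y : dot x (a *: y) = a * dot x y.
Proof. by rewrite dotC dotZl dotC. Qed.

Lemma dotBl x y z : dot (x - y) z = dot x z - dot y z.
Proof. by rewrite -scaleN1r dotDl dotZl mulN1r. Qed.

Lemma dot_delta i x : dot (delta_mx i ord0) x = x i ord0.
Proof.
rewrite dotE (bigD1 i) //= big1 => [|j ji].
  by rewrite mxE !eqxx mul1r addr0.
by rewrite mxE (negPf ji) mul0r.
Qed.

Lemma dot_onesr x : dot x (ones R n) = \sum_i x i ord0.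
Proof. by rewrite dotE; apply: eq_bigr => i _; rewrite mxE mulr1. Qed.

Lemma dot_ones_ones : dot (ones R n) (ones R n) = n%:R.
Proof.
rewrite dot_onesr (eq_bigr (fun=> 1)) => [|i _]; last by rewrite mxE.
by rewrite sumr_const card_ord.
Qed.

Lemma dot_ge0 x : 0 <= dot x x.
Proof. by rewrite dotE; apply: sumr_ge0 => i _; rewrite -expr2 sqr_ge0. Qed.

Lemma dot_eq0 x : dot x x = 0 -> x = 0.
Proof.
rewrite dotE => /eqP; rewrite psumr_eq0 => [/allP x0|i _]; last first.
  by rewrite -expr2 sqr_ge0.
apply/colP => i; rewrite mxE; apply/eqP.
by have := x0 i (mem_index_enum i); rewrite /= mulf_eq0 orbb.
Qed.

Lemma dot_gt0 x : x != 0 -> 0 < dot x x.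
Proof.
by move=> x0; rewrite lt0r dot_ge0 andbT; apply: contra_neq x0 => /dot_eq0.
Qed.

Lemma enorm1 x : enorm x = 1 <-> dot x x = 1.
Proof.
rewrite /enorm; split=> [x1|->]; last exact: sqrtr1.
by rewrite -(sqr_sqrtr (dot_ge0 x)) x1 expr1n.
Qed.

Lemma qformE M x : qform M x = dot x (M *m x).
Proof. by rewrite /qform /dot mulmxA. Qed.

Lemma qform_sum M x :
  qform M x = \sum_i \sum_j M i j * (x i ord0 * x j ord0).
Proof.
rewrite qformE dotE; apply: eq_bigr => i _; rewrite mxE mulr_sumr.
by apply: eq_bigr => j _; ring.
Qed.

Lemma dot_mulmx_sym M x y : M^T = M -> dot x (M *m y) = dot (M *m x) y.
Proof. by move=> sM; rewrite /dot trmx_mul sM mulmxA. Qed.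

Lemma qformZ M a x : qform M (a *: x) = a ^+ 2 * qform M x.
Proof. by rewrite !qformE -scalemxAr dotZl dotZr mulrA. Qed.

Lemma qformD M x y : M^T = M ->
  qform M (x + y) = qform M x + 2 * dot y (M *m x) + qform M y.
Proof.
move=> sM; rewrite !qformE mulmxDr !(dotDl, dotDr).
by rewrite [dot x (M *m y)]dot_mulmx_sym // [dot _ y]dotC; ring.
Qed.

(** Moving from [x] in the direction [- M x] would make the form negative
    to first order unless [M x = 0]. *)
Lemma psd_qform_eq0 M x : M^T = M -> (forall y, 0 <= qform M y) ->
  qform M x = 0 -> M *m x = 0.
Proof.
move=> sM psd qx0; apply: contrapT => /eqP/dot_gt0.
set y := M *m x; set d := dot y y => d_gt0.
(* At this step length the second-order term is at most half of the
   first-order decrease [2 s d]. *)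
pose s := d / (qform M y + 1).
have c_ge0 := psd y.
have s_gt0 : 0 < s by rewrite divr_gt0 // ltr_wpDl.
have sE : s * (qform M y + 1) = d by rewrite divfK // gt_eqF // ltr_wpDl.
have := psd (x + (- s) *: y).
rewrite qformD // qformZ qx0 dotZl -/y -/d sqrrN -{}sE.
move: (qform M y) c_ge0 => c c_ge0; nra.
Qed.

End QuadraticForms.

(** * Laplacians of weight matrices *)

Section WeightedLaplacian.
Variables (R : realType) (n : nat).
Implicit Types (W : 'M[R]_n) (x : 'cV[R]_n).

(** The combinatorial Laplacian is the case of adjacency weights, the
    resistance Laplacian that of resistance weights. *)
Definition weighted_laplacian W : 'M[R]_n :=
  diag_mx (W *m ones R n)^T - W.

Lemma weighted_laplacian_sym W :
  W^T = W -> (weighted_laplacian W)^T = weighted_laplacian W.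
Proof. by move=> sW; rewrite /weighted_laplacian linearB /= tr_diag_mx sW. Qed.

Lemma weighted_laplacian_ones W : weighted_laplacian W *m ones R n = 0.
Proof.
rewrite /weighted_laplacian mulmxBl; apply/eqP; rewrite subr_eq0; apply/eqP.
by apply/colP => i; rewrite mul_diag_mx !mxE mulr1.
Qed.

Lemma qform_weighted_laplacian W x : W^T = W ->
  qform (weighted_laplacian W) x =
  2^-1 * \sum_i \sum_j W i j * (x i ord0 - x j ord0) ^+ 2.
Proof.
move=> sW.
have Wsym i j : W j i = W i j by rewrite -{1}sW mxE.
have rowsq : \sum_i \sum_j W i j * x i ord0 ^+ 2 =
    \sum_i \sum_j W i j * x j ord0 ^+ 2.
  rewrite exchange_big; apply: eq_bigr => i _.
  by apply: eq_bigr => j _; rewrite Wsym.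
have -> : \sum_i \sum_j W i j * (x i ord0 - x j ord0) ^+ 2 =
    \sum_i \sum_j W i j * x i ord0 ^+ 2 + \sum_i \sum_j W i j * x j ord0 ^+ 2
    - 2 * \sum_i \sum_j W i j * (x i ord0 * x j ord0).
  rewrite mulr_sumr -sumrN -!big_split; apply: eq_bigr => i _ /=.
  rewrite mulr_sumr -sumrN -!big_split; apply: eq_bigr => j _ /=; ring.
rewrite -rowsq qformE /weighted_laplacian mulmxBl dotDr.
rewrite -[- (W *m x)]scaleN1r dotZr -qformE qform_sum.
have -> : dot x (diag_mx (W *m ones R n)^T *m x) =
    \sum_i \sum_j W i j * x i ord0 ^+ 2.
  rewrite dotE; apply: eq_bigr => i _; rewrite mul_diag_mx !mxE -mulr_suml.
  under [in RHS]eq_bigr do rewrite -[W _ _]mulr1.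
  by rewrite (eq_bigr (fun j => W i j * 1)) => [|j _]; [ring | rewrite mxE].
by field.
Qed.

Lemma weighted_laplacian_psd W x : W^T = W -> (forall i j, 0 <= W i j) ->
  0 <= qform (weighted_laplacian W) x.
Proof.
move=> sW W0; rewrite qform_weighted_laplacian // mulr_ge0 ?invr_ge0 //.
by do 2![apply: sumr_ge0 => ? _]; rewrite mulr_ge0 ?sqr_ge0.
Qed.

(** A sum of nonnegative weighted squares vanishes termwise. *)
Lemma qform_weighted_laplacian_eq0 W x i j : W^T = W ->
    (forall i j, 0 <= W i j) -> qform (weighted_laplacian W) x = 0 ->
  0 < W i j -> x i ord0 = x j ord0.
Proof.
move=> sW W0; rewrite qform_weighted_laplacian // => /eqP.
have sq_ge0 k l : 0 <= W k l * (x k ord0 - x l ord0) ^+ 2.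
  by rewrite mulr_ge0 ?sqr_ge0.
rewrite mulf_eq0 invr_eq0 pnatr_eq0 /= psumr_eq0 => [/allP/(_ i)|k _]; last first.
  exact: sumr_ge0.
rewrite mem_index_enum psumr_eq0 // => /(_ isT)/allP/(_ j).
rewrite mem_index_enum => /(_ isT) /=.
rewrite mulf_eq0 sqrf_eq0 subr_eq0 => /orP[/eqP->|/eqP//].
by rewrite ltxx.
Qed.

End WeightedLaplacian.

(** * Effective resistances *)

Section Resistance.
Variables (R : realType) (n : nat) (e : rel 'I_n).
Implicit Types (x : 'cV[R]_n).

Lemma laplacianE : laplacian R e = weighted_laplacian (adjacency R e).
Proof.
rewrite /laplacian /weighted_laplacian; congr (diag_mx _ - _).
apply/rowP => i; rewrite !mxE /degree -sum1dep_card natr_sum big_mkcond /=.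
by apply: eq_bigr => j _; rewrite !mxE mulr1; case: (e i j).
Qed.

Lemma resistance_laplacianE :
  resistance_laplacian R e = weighted_laplacian (resistance_matrix R e).
Proof. by []. Qed.

(** Holds for every graph: when nothing satisfies the pseudoinverse equations
    the selected matrix is 0, which is symmetric. *)
Lemma laplacian_pinv_sym : (laplacian_pinv R e)^T = laplacian_pinv R e.
Proof. by rewrite /laplacian_pinv; case: xgetP => [_ _ []//|_]; rewrite trmx0. Qed.

Lemma resistance_sym i j : resistance R e i j = resistance R e j i.
Proof.
by rewrite /resistance -[in X in 2 * X]laplacian_pinv_sym mxE [X in X - _]addrC.
Qed.

Lemma resistance_matrix_sym : (resistance_matrix R e)^T = resistance_matrix R e.
Proof. by apply/matrixP => i j; rewrite !mxE resistance_sym. Qed.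

Hypothesis e_sym : symmetric e.

Lemma adjacency_sym : (adjacency R e)^T = adjacency R e.
Proof. by apply/matrixP => i j; rewrite !mxE e_sym. Qed.

Lemma adjacency_ge0 i j : 0 <= adjacency R e i j.
Proof. by rewrite mxE ler0n. Qed.

Lemma laplacian_sym : (laplacian R e)^T = laplacian R e.
Proof. by rewrite laplacianE weighted_laplacian_sym // adjacency_sym. Qed.

Lemma laplacian_ones : laplacian R e *m ones R n = 0.
Proof. by rewrite laplacianE weighted_laplacian_ones. Qed.

Lemma laplacian_psd x : 0 <= qform (laplacian R e) x.
Proof.
rewrite laplacianE weighted_laplacian_psd //; first exact: adjacency_sym.
exact: adjacency_ge0.
Qed.

Hypothesis e_conn : forall i j : 'I_n, connect e i j.

(** Zero energy forces equality along each edge, hence along paths. *)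
Lemma laplacian_ker_const x :
  qform (laplacian R e) x = 0 -> forall i j, x i ord0 = x j ord0.
Proof.
move=> qx0 i j.
have edge k l : e k l -> x k ord0 = x l ord0.
  move=> ekl; move: qx0; rewrite laplacianE => qx0.
  apply: (qform_weighted_laplacian_eq0 adjacency_sym adjacency_ge0 qx0).
  by rewrite mxE ekl ltr01.
have /connectP[p + ->] := e_conn i j.
by elim: p i => //= k p IHp i /andP[/edge-> /IHp].
Qed.

Hypothesis n_gt0 : (0 < n)%N.

(** Adding the projector [J] onto the constants makes the Laplacian of a
    connected graph invertible without changing its action on their orthogonal
    complement; subtracting [J] from the inverse then restores the kernel. *)
Lemma is_laplacian_pinv_ex :
  exists P : 'M[R]_n, is_laplacian_pinv (laplacian R e) P.
Proof.
pose one := ones R n.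
pose J : 'M[R]_n := n%:R^-1 *: (one *m one^T).
have nz : n%:R != 0 :> R by rewrite pnatr_eq0 -lt0n.
have one2 : one^T *m one = n%:R%:M.
  by rewrite [LHS]mx11_scalar -[X in X%:M]/(dot one one) dot_ones_ones.
have sJ : J^T = J by rewrite /J linearZ /= trmx_mul trmxK.
have J1 : J *m one = one.
  by rewrite /J -scalemxAl -mulmxA one2 mul_mx_scalar scalerA mulVf ?scale1r.
have JJ : J *m J = J by rewrite {2}/J -scalemxAr mulmxA J1.
have L1 : laplacian R e *m one = 0 := laplacian_ones.
have LJ : laplacian R e *m J = 0 by rewrite /J -scalemxAr mulmxA L1 mul0mx scaler0.
pose N := laplacian R e + J.
have sN : N^T = N by rewrite /N linearD /= laplacian_sym sJ.
have N1 : N *m one = one by rewrite /N mulmxDl L1 J1 add0r.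
have NJ : N *m J = J by rewrite /N mulmxDl LJ JJ add0r.
have uN : N \in unitmx.
  rewrite -row_free_unit; apply: inj_row_free => v vN.
  pose x : 'cV[R]_n := v^T.
  have Nx : N *m x = 0 by rewrite -[LHS]trmxK trmx_mul trmxK sN vN trmx0.
  have sumx : dot x one = 0.
    by rewrite dotC /dot -N1 trmx_mul sN -mulmxA Nx mulmx0 mxE.
  have qx : qform (laplacian R e) x = 0.
    have Jx : J *m x = 0.
      rewrite /J -scalemxAl -mulmxA [one^T *m x]mx11_scalar.
      by rewrite -[_ ord0 ord0]/(dot one x) dotC sumx mul_mx_scalar scale0r scaler0.
    by rewrite qformE -[_ *m x]addr0 -Jx -mulmxDl Nx /dot mulmx0 mxE.
  apply/rowP => i; rewrite mxE; move: sumx; rewrite dot_onesr.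
  rewrite (eq_bigr (fun=> v ord0 i)) => [|j _]; last first.
    by rewrite (laplacian_ker_const qx j i) mxE.
  rewrite sumr_const card_ord -mulr_natl => /eqP.
  by rewrite mulf_eq0 (negPf nz) => /eqP.
have N'1 : invmx N *m one = one by rewrite -{1}N1 mulKmx.
have N'J : invmx N *m J = J by rewrite -{1}NJ mulKmx.
have sN' : (invmx N)^T = invmx N by rewrite trmx_inv sN.
have LP : laplacian R e *m (invmx N - J) = 1%:M - J.
  have -> : laplacian R e *m (invmx N - J) = laplacian R e *m invmx N.
    by rewrite mulmxBr LJ subr0.
  have -> : laplacian R e = N - J by rewrite /N addrK.
  rewrite mulmxBl mulmxV //; congr (_ - _).
  by rewrite -[LHS]trmxK trmx_mul sN' sJ N'J sJ.
have sP : (invmx N - J)^T = invmx N - J by rewrite linearB /= sN' sJ.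
exists (invmx N - J); split=> //.
- rewrite -[LHS]trmxK trmx_mul sP laplacian_sym LP.
  by rewrite linearB /= trmx1 sJ.
- by rewrite mulmxBl N'1 J1 subrr.
Qed.

Lemma laplacian_pinvP : is_laplacian_pinv (laplacian R e) (laplacian_pinv R e).
Proof. by have [P /xgetI] := is_laplacian_pinv_ex; apply. Qed.

(** With [y] the potential of a unit current from [i] to [j], the resistance is
    the energy [y^T L y]; it can only vanish if [L y = 0], but [L y] is the
    nonzero current itself. *)
Lemma resistance_gt0 i j : i != j -> 0 < resistance R e i j.
Proof.
move=> ij; have [sP LP PL P1] := laplacian_pinvP.
set P := laplacian_pinv R e in sP LP PL P1 *; set L := laplacian R e in LP PL.
pose d : 'cV[R]_n := delta_mx i ord0 - delta_mx j ord0.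
have sumd : dot d (ones R n) = 0.
  by rewrite /d dotBl !dot_delta !mxE subrr.
have LPd : L *m (P *m d) = d.
  rewrite mulmxA LP mulmxBl mul1mx -scalemxAl -mulmxA.
  rewrite [(ones R n)^T *m d]mx11_scalar -[_ ord0 ord0]/(dot (ones R n) d).
  by rewrite dotC sumd mul_mx_scalar scale0r scaler0 subr0.
have rE : resistance R e i j = qform L (P *m d).
  rewrite qformE LPd dotC /d dotBl !dot_delta mulmxBr -!colE !mxE /resistance.
  rewrite -/P.
  have -> : P j i = P i j by rewrite -{1}sP mxE.
  ring.
rewrite rE lt0r laplacian_psd andbT.
apply/eqP => /(psd_qform_eq0 laplacian_sym laplacian_psd); rewrite -/L LPd.
move/colP/(_ i)/eqP; rewrite !mxE eqxx (negPf ij) subr0.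
by rewrite oner_eq0.
Qed.

Lemma resistance_ge0 i j : 0 <= resistance R e i j.
Proof.
have [->|/resistance_gt0/ltW//] := eqVneq i j.
suff -> : resistance R e j j = 0 by [].
by rewrite /resistance; ring.
Qed.

End Resistance.

(** * Maximizing a quadratic form on the unit sphere orthogonal to the constants *)

Section ConstrainedRayleigh.
Variables (R : realType) (n : nat).
Implicit Types (M : 'M[R]_n) (x y z : 'cV[R]_n).

Definition constrained_rayleigh M : max_problem R 'cV[R]_n :=
  {| feasible := [set x : 'cV[R]_n | enorm x = 1 /\ dot x (ones R n) = 0]%classic;
     objective := qform M |}.

Lemma feasible_normalize M z : z != 0 -> dot z (ones R n) = 0 ->
  feasible (constrained_rayleigh M) ((enorm z)^-1 *: z).
Proof.
move=> z0 z1; split; last by rewrite dotZl z1 mulr0.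
apply/enorm1; rewrite dotZl dotZr mulrA -expr2 exprVn.
by rewrite sqr_sqrtr ?dot_ge0 // mulVf // gt_eqF // dot_gt0.
Qed.

Let sum_continuous (f : 'I_n -> 'rV[R]_n -> R) :
  (forall i, continuous (f i)) -> continuous (fun v => \sum_i f i v).
Proof. by move=> cf; apply: (continuous_big (@add_continuous R)) => i _. Qed.

Lemma dot_ones_continuous :
  continuous (fun v : 'rV[R]_n => dot v^T (ones R n)).
Proof.
under eq_fun do rewrite dot_onesr.
apply: sum_continuous => i; under eq_fun do rewrite mxE.
exact: coord_continuous.
Qed.

Lemma qform_continuous M : continuous (fun v : 'rV[R]_n => qform M v^T).
Proof.
have -> : (fun v : 'rV[R]_n => qform M v^T) =
    (fun v => \sum_i \sum_j M i j * (v ord0 i * v ord0 j)).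
  apply/funext => v; rewrite qform_sum; apply: eq_bigr => i _.
  by apply: eq_bigr => j _; rewrite !mxE.
have mono i j : continuous (fun v : 'rV[R]_n => M i j * (v ord0 i * v ord0 j)).
  move=> v; apply: (@continuousM R _ (fun=> M i j)
    (fun w : 'rV[R]_n => w ord0 i * w ord0 j)); first exact: cst_continuous.
  by apply: (@continuousM R _ (fun w : 'rV[R]_n => w ord0 i)
    (fun w : 'rV[R]_n => w ord0 j)); exact: coord_continuous.
apply: (@sum_continuous (fun i v => \sum_j M i j * (v ord0 i * v ord0 j))) => i.
exact: sum_continuous.
Qed.

Lemma dot_continuous : continuous (fun v : 'rV[R]_n => dot v^T v^T).
Proof.
have -> : (fun v : 'rV[R]_n => dot v^T v^T) = (fun v => qform 1%:M v^T).
  by apply/funext => v; rewrite qformE mul1mx.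
exact: qform_continuous.
Qed.

(** The feasible set is compact, and nonempty from dimension 2 on. *)
Lemma constrained_rayleigh_max M : (1 < n)%N ->
  exists x, maximizer (constrained_rayleigh M) x.
Proof.
move=> n_gt1.
pose S := [set v : 'rV[R]_n | feasible (constrained_rayleigh M) v^T]%classic.
have S_ne : (S !=set0)%classic.
  pose i := Ordinal (ltnW n_gt1); pose j := Ordinal n_gt1.
  pose d : 'cV[R]_n := delta_mx i ord0 - delta_mx j ord0.
  have d_neq0 : d != 0.
    apply/eqP => /colP/(_ i)/eqP.
    by rewrite !mxE !eqxx /= subr0 oner_eq0.
  have sumd : dot d (ones R n) = 0 by rewrite /d dotBl !dot_delta !mxE subrr.
  by exists ((enorm d)^-1 *: d)^T; rewrite /S /mkset trmxK; exact: feasible_normalize.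
have S_cpt : compact S.
  apply: bounded_closed_compact.
    exists 1; split=> // m m_gt1 v [/enorm1 v1 _].
    apply: le_trans (ltW m_gt1); rewrite [`|v|]mx_normrE.
    apply: bigmax_le => // -[k i] _ /=.
    rewrite -(@expr_le1 _ 2) // real_normK ?num_real // ord1.
    rewrite -v1 dotE (bigD1 i) //= mxE expr2 lerDl.
    by apply: sumr_ge0 => l _; rewrite -expr2 sqr_ge0.
  have -> : S = ((fun v : 'rV[R]_n => dot v^T v^T) @^-1` [set 1%R] `&`
      (fun v : 'rV[R]_n => dot v^T (ones R n)) @^-1` [set 0%R])%classic.
    by apply/seteqP; split=> v [/enorm1 ? ?].
  apply: closedI; apply: preimage_closed => [v _|]; try exact: closed_eq.
    exact: dot_continuous.
  exact: dot_ones_continuous.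
have S_cont : {within S, continuous (fun v : 'rV[R]_n => qform M v^T)}%classic.
  exact: continuous_subspaceT (@qform_continuous M).
have [v vS vmax] := EVT_max_rV S_ne S_cpt S_cont.
exists v^T; split; first by move: vS; rewrite inE.
move=> y yF; have := vmax y^T; rewrite inE /S /mkset trmxK; exact.
Qed.

Variable M : 'M[R]_n.
Hypotheses (M_sym : M^T = M) (M_ones : M *m ones R n = 0).
Hypothesis M_pos : forall x, x != 0 -> dot x (ones R n) = 0 -> 0 < qform M x.

Lemma maximizer_gt0 x : maximizer (constrained_rayleigh M) x -> 0 < qform M x.
Proof.
case=> -[/enorm1 x1 xo] _; apply: M_pos => //.
by apply/eqP => x0; move: x1; rewrite x0 dotE big1 => [/esym/eqP|i _];
  rewrite ?oner_eq0 // mxE mul0r.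
Qed.

(** By homogeneity the bound holds on the orthogonal complement of the constants;
    a constant component of [z] adds to the right-hand side only, as the
    maximal value is positive. *)
Lemma maximizer_bound x z : maximizer (constrained_rayleigh M) x ->
  qform M z <= qform M x * dot z z.
Proof.
move=> xmax; have lx := maximizer_gt0 xmax; have [_ xub] := xmax.
have [n0|n_gt0] := posnP n.
  suff -> : z = 0 by rewrite qformE /dot mulmx0 !mulmx0 !mxE mulr0.
  by apply/colP => i; move: (ltn_ord i); rewrite {2}n0.
pose c := dot z (ones R n) / n%:R.
have [w w1 zE] : exists2 w, dot w (ones R n) = 0 & z = w + c *: ones R n.
  exists (z - c *: ones R n); last by rewrite subrK.
  by rewrite dotBl dotZl dot_ones_ones divfK ?subrr // pnatr_eq0 -lt0n.
have qz : qform M z = qform M w.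
  rewrite zE qformD // qformZ [qform M (ones _ _)]qformE M_ones.
  rewrite dot_mulmx_sym // -scalemxAr M_ones scaler0.
  by rewrite /dot trmx0 mul0mx mulmx0 !mxE; ring.
have dz : dot z z = dot w w + c ^+ 2 * n%:R.
  rewrite zE !(dotDl, dotDr) !(dotZl, dotZr) [dot (ones _ _) w]dotC w1.
  by rewrite dot_ones_ones; ring.
have qw : qform M w <= qform M x * dot w w.
  have [->|w0] := eqVneq w 0; first by rewrite qformE /dot !mulmx0 !mxE mulr0.
  have := xub _ (feasible_normalize M w0 w1).
  rewrite /= qformZ exprVn sqr_sqrtr ?dot_ge0 // mulrC.
  by rewrite ler_pdivrMr // dot_gt0.
rewrite qz dz mulrDr; apply: le_trans qw _; rewrite lerDl.
by apply: mulr_ge0; [exact: ltW | rewrite mulr_ge0 ?sqr_ge0].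
Qed.

(** The form of [l I - M] is nonnegative and vanishes at [x]: this replaces the
    Lagrange multiplier. *)
Lemma maximizer_eigen x : maximizer (constrained_rayleigh M) x ->
  M *m x = qform M x *: x.
Proof.
move=> xmax; have [[/enorm1 x1 _] _] := xmax; set l := qform M x.
have sN : (l%:M - M)^T = l%:M - M by rewrite linearB /= tr_scalar_mx M_sym.
have qN z : qform (l%:M - M) z = l * dot z z - qform M z.
  rewrite qformE mulmxBl mul_scalar_mx dotDr dotZr -scaleN1r dotZr.
  by rewrite -qformE mulN1r.
have psdN z : 0 <= qform (l%:M - M) z.
  by rewrite qN subr_ge0; exact: maximizer_bound.
have /(psd_qform_eq0 sN psdN) : qform (l%:M - M) x = 0.
  by rewrite qN x1 mulr1 subrr.
by rewrite mulmxBl mul_scalar_mx => /eqP; rewrite subr_eq0 => /eqP.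
Qed.

Lemma maximizer_largest x : maximizer (constrained_rayleigh M) x ->
  largest_eigenvalue M (qform M x).
Proof.
move=> xmax; have [[/enorm1 x1 _] _] := xmax; split.
  apply/eigenvalueP; exists x^T.
    by rewrite -{1}M_sym -trmx_mul (maximizer_eigen xmax) linearZ.
  apply/eqP => /(congr1 trmx); rewrite trmxK trmx0 => x0.
  by move: x1; rewrite x0 /dot mulmx0 mxE => /esym/eqP; rewrite oner_eq0.
move=> m /eigenvalueP[v vM v0].
have v'0 : v^T != 0.
  by apply/eqP => /(congr1 trmx); rewrite trmxK trmx0; apply/eqP.
have := maximizer_bound v^T xmax.
have Mv : M *m v^T = m *: v^T by rewrite -{1}M_sym -trmx_mul vM linearZ.
by rewrite [qform M v^T]qformE Mv dotZr ler_pM2r // dot_gt0.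
Qed.

(** Eigenvectors for a positive eigenvalue are orthogonal to the kernel, hence
    feasible. *)
Lemma maximizer_dominantP x : (1 < n)%N ->
  maximizer (constrained_rayleigh M) x <->
  dominant_eigenvector M x /\ enorm x = 1.
Proof.
move=> n_gt1; split=> [xmax|[[x0 [l [l_eig l_max] xl]] xn]].
  have [[xn _] _] := xmax; split=> //; split; last first.
    by exists (qform M x); [exact: maximizer_largest | exact: maximizer_eigen].
  apply/eqP => x0; have := maximizer_gt0 xmax.
  by rewrite x0 qformE /dot !mulmx0 mxE ltxx.
have [y ymax] := constrained_rayleigh_max M n_gt1.
have [y_eig y_max] := maximizer_largest ymax.
have lE : l = qform M y.
  by apply/eqP; rewrite eq_le y_max ?l_max.
have xo : dot x (ones R n) = 0.
  have : dot (M *m x) (ones R n) = 0.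
    by rewrite -dot_mulmx_sym // M_ones /dot mulmx0 mxE.
  rewrite xl dotZl => /eqP; rewrite mulf_eq0 lE gt_eqF ?maximizer_gt0 //.
  by move=> /eqP.
split=> //= z zF; have [_ /(_ z zF) /= zy] := ymax.
by rewrite [qform M x]qformE xl dotZr ((enorm1 x).1 xn) mulr1 lE.
Qed.

End ConstrainedRayleigh.

(** * Indicator vectors of balanced partitions *)

Section PartitionVectors.
Variables (R : realType) (n : nat).
Hypothesis n_gt1 : (1 < n)%N.
Implicit Types (A B : {set 'I_n}) (x : 'cV[R]_n) (W : 'M[R]_n).

Let s : R := (Num.sqrt n%:R)^-1.

Let s_gt0 : 0 < s.
Proof. by rewrite invr_gt0 sqrtr_gt0 ltr0n ltnW. Qed.

Let s_sqr : s ^+ 2 = n%:R^-1.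
Proof. by rewrite exprVn sqr_sqrtr ?ler0n. Qed.

Let s_neqN : (s == - s) = false.
Proof. by apply/negbTE; rewrite -addr_eq0; apply/lt0r_neq0/addr_gt0. Qed.

Lemma bipartition_setC A B : bipartition A B -> B = ~: A.
Proof.
case=> _ _ AB0 ABT; apply/setP => i.
have := finset.in_setT i; have := finset.in_set0 i.
rewrite -AB0 -ABT !inE; by case: (i \in A); case: (i \in B).
Qed.

Lemma partition_vectorE A i :
  partition_vector R (A, ~: A) i ord0 = if i \in A then s else - s.
Proof.
rewrite !mxE inE -/s; case: (i \in A); first by rewrite subr0 mulr1.
by rewrite sub0r mulrN1.
Qed.

Lemma mem_partition_vector A i :
  (i \in A) = (partition_vector R (A, ~: A) i ord0 == s).
Proof.
by rewrite partition_vectorE; case: (i \in A); rewrite ?eqxx // eq_sym s_neqN.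
Qed.

Lemma partition_vector_sum A B :
  dot (partition_vector R (A, B)) (ones R n) = s * (#|A|%:R - #|B|%:R).
Proof.
rewrite /partition_vector -/s dotZl dotBl /=; congr (_ * (_ - _));
  rewrite dot_onesr -sum1_card natr_sum [in RHS]big_mkcond;
  by apply: eq_bigr => i _; rewrite mxE; case: (i \in _).
Qed.

Lemma partition_vector_norm A :
  dot (partition_vector R (A, ~: A)) (partition_vector R (A, ~: A)) = 1.
Proof.
rewrite dotE (eq_bigr (fun=> n%:R^-1)) => [|i _].
  by rewrite sumr_const card_ord -[LHS]mulr_natl mulfV // pnatr_eq0 -lt0n ltnW.
by rewrite partition_vectorE -s_sqr; case: (i \in A); rewrite ?mulrNN -expr2.
Qed.

(** Two coordinates differ by [2 / sqrt n] exactly on the pairs that are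
    cut. *)
Lemma qform_partition_vector W A : W^T = W ->
  qform (weighted_laplacian W) (partition_vector R (A, ~: A)) =
  4 / n%:R * \sum_(i in A) \sum_(j in ~: A) W i j.
Proof.
move=> sW; rewrite qform_weighted_laplacian //.
have Wsym i j : W j i = W i j by rewrite -{1}sW mxE.
set x := partition_vector R _; set cut := \sum_(i in A) _.
have -> : \sum_i \sum_j W i j * (x i ord0 - x j ord0) ^+ 2 =
    4 / n%:R * (cut + \sum_(i in ~: A) \sum_(j in A) W i j).
  rewrite mulrDr /cut !mulr_sumr (bigID (mem A)) /=; congr (_ + _).
    apply: eq_bigr => i iA; rewrite mulr_sumr [RHS]big_mkcond.
    apply: eq_bigr => j _ /=; rewrite !partition_vectorE iA inE.
    case: (j \in A) => /=; first by rewrite subrr expr0n mulr0.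
    by rewrite -s_sqr; ring.
  apply: eq_big => [i|i iA]; first by rewrite inE.
  rewrite mulr_sumr [RHS]big_mkcond.
  apply: eq_bigr => j _ /=; rewrite !partition_vectorE (negPf iA).
  case: (j \in A) => /=; last by rewrite subrr expr0n mulr0.
  by rewrite -s_sqr; ring.
have -> : \sum_(i in ~: A) \sum_(j in A) W i j = cut.
  rewrite exchange_big; apply: eq_bigr => i _.
  by apply: eq_bigr => j _; rewrite Wsym.
by field; rewrite pnatr_eq0 -lt0n ltnW.
Qed.

Variable e : rel 'I_n.

Lemma RRC_balanced A B : balanced A B ->
  RRC R e A B = 4 / n%:R * ResCut R e A B.
Proof.
rewrite /RRC; case=> even_n -> ->.
have nE : n%:R = 2 * (n./2)%:R :> R.
  by rewrite -natrM mul2n -[in LHS](odd_double_half n) (negPf even_n).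
have h0 : (n./2)%:R != 0 :> R by rewrite pnatr_eq0 -lt0n half_gt0.
by rewrite nE; field.
Qed.

(** A vector with all coordinates [+- 1 / sqrt n] automatically has unit norm;
    orthogonality to the constants says that both signs occur equally often,
    that is, that the partition by signs is balanced. *)
Lemma partition_vector_relaxation :
  continuous_relaxation (@partition_vector R n) [:: s; - s]
    (balanced_RRC_problem R e) (relaxed_problem R e).
Proof.
split.
- move=> [A B] [A' B']; rewrite !inE => -[/= pAB _] [/= pAB' _].
  rewrite (bipartition_setC pAB) (bipartition_setC pAB') => eqv.
  suff -> : A = A' by [].
  by apply/setP => i; rewrite !mem_partition_vector eqv.
- apply/seteqP; split=> x.
    case=> -[A B] [/= pAB [_ cA cB]] <-; split; first split.
    + by rewrite (bipartition_setC pAB); apply/enorm1/partition_vector_norm.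
    + by rewrite partition_vector_sum cA cB subrr mulr0.
    move=> i; rewrite (bipartition_setC pAB) partition_vectorE !inE.
    by case: ifP; rewrite eqxx ?orbT.
  case=> -[/= x1 xo] x_val; pose A := [set i | x i ord0 == s]%SET.
  have xE : partition_vector R (A, ~: A) = x.
    apply/colP => i; rewrite partition_vectorE inE.
    by have := x_val i; rewrite !inE; case: eqP => [->//|_ /= /eqP].
  have cardAC : #|A| = #|~: A|.
    move: xo; rewrite -xE partition_vector_sum => /eqP.
    by rewrite mulf_eq0 gt_eqF //= subr_eq0 eqr_nat => /eqP.
  have nE : n = #|A|.*2.
    by rewrite -addnn {2}cardAC cardsC card_ord.
  have cardA : #|A| = n./2 by have := congr1 half nE; rewrite doubleK => ->.
  have half_n : (0 < n./2)%N by rewrite half_gt0.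
  exists (A, ~: A) => //=; split; last first.
    by split=> //; [rewrite nE odd_double | rewrite -cardAC].
  split; rewrite -?card_gt0 -?cardAC ?cardA //; first exact: finset.setICr.
  exact: finset.setUCr.
- move=> [A B] [/= pAB bal].
  rewrite RRC_balanced // (bipartition_setC pAB) resistance_laplacianE.
  rewrite qform_partition_vector; last exact: resistance_matrix_sym.
  congr (_ * _); rewrite /ResCut.
  by apply: eq_bigr => i _; apply: eq_bigr => j _; rewrite mxE.
Qed.

End PartitionVectors.

(** * The relaxed problem and its maximizers *)

(** Every resistance is positive, so the energy of [x] can only vanish when all
    coordinates agree. *)
Lemma resistance_laplacian_gt0 (R : realType) (n : nat) (e : rel 'I_n)
    (x : 'cV[R]_n) :
    symmetric e -> (forall i j : 'I_n, connect e i j) -> (0 < n)%N ->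
  x != 0 -> dot x (ones R n) = 0 -> 0 < qform (resistance_laplacian R e) x.
Proof.
move=> e_sym e_conn n_gt0 x0 xo; rewrite resistance_laplacianE.
have sR := resistance_matrix_sym R e.
have R0 i j : 0 <= resistance_matrix R e i j.
  by rewrite mxE resistance_ge0.
rewrite lt0r weighted_laplacian_psd // andbT.
apply: contra_neq x0 => qx0; apply/colP => i; rewrite mxE.
have xconst j : x j ord0 = x i ord0.
  have [->//|ji] := eqVneq j i.
  by apply: (qform_weighted_laplacian_eq0 sR R0 qx0); rewrite mxE resistance_gt0.
move: xo; rewrite dot_onesr (eq_bigr (fun=> x i ord0)) => [|j _]; last exact: xconst.
rewrite sumr_const card_ord -mulr_natl => /eqP.
by rewrite mulf_eq0 pnatr_eq0 eqn0Ngt n_gt0 => /eqP.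
Qed.

Theorem theorem3p4 (R : realType) (n : nat) (n_gt1 : (1 < n)%N) (e : rel 'I_n)
    (e_sym : symmetric e) (e_irr : irreflexive e)
    (e_conn : forall i j : 'I_n, connect e i j) :
  continuous_relaxation (@partition_vector R n)
    [:: (Num.sqrt n%:R)^-1; - (Num.sqrt n%:R)^-1]
    (balanced_RRC_problem R e) (relaxed_problem R e)
  /\ (exists x : 'cV[R]_n, maximizer (relaxed_problem R e) x)
  /\ (forall x : 'cV[R]_n,
        maximizer (relaxed_problem R e) x
        <-> dominant_eigenvector (resistance_laplacian R e) x /\ enorm x = 1).
Proof.
split; first exact: partition_vector_relaxation.
split; first exact: (constrained_rayleigh_max (resistance_laplacian R e)).
move=> x; apply: (@maximizer_dominantP _ _ (resistance_laplacian R e)) => //.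
- by rewrite resistance_laplacianE weighted_laplacian_sym // resistance_matrix_sym.
- exact: weighted_laplacian_ones.
- by move=> y; apply: resistance_laplacian_gt0 => //; exact: ltnW.
Qed.
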